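(* Let $p\ge2$, $m\in\mathbb{N}$, $a,b>0$, consider the multiple regression function $f(x)=(1,x^T)^T$ on the rectangular design region $\mathcal{X}=[u_1,v_1]\times\cdots\times[u_{p-1},v_{p-1}]$ with $u_i<v_i$, and let $\beta=(\beta_0,\ldots,\beta_{p-1})^T$ with $\beta_i\neq0$ for $i=1,\ldots,p-1$. Let $d=(d_1,\ldots,d_{p-1})$ with $d_i=v_i$ if $\beta_i>0$ and $d_i=u_i$ if $\beta_i<0$. For $z>0$ define $$w_p^*(z)=\frac{2}{p+\sqrt{(p-2)^2+4(p-1)\dfrac{1+\frac{m}{b}\exp(f(d)^T\beta)}{1+\frac{m}{b}\exp(f(d)^T\beta-z)}}},\qquad w_1^*(z)=\frac{1-w_p^*(z)}{p-1}.$$ Then the equation $$0=m\Bigl((p-1)w_1^*(z)e^{f(d)^T\beta-z}+w_p^*(z)e^{f(d)^T\beta}\Bigr)\bigl(z(p-1)w_1^*(z)-2\bigr)+b\bigl(zp\,w_1^*(z)-2\bigr)$$ has a unique solution $z^*\in(0,\infty)$. If moreover $z^*\le\min_{i=1,\ldots,p-1}|\beta_i|(v_i-u_i)$, then the design $\xi^*$ which assigns weight $w_1^*(z^* )$ to each of the points $d-(z^*/\beta_i)e_i$, $i=1,\ldots,p-1$, and weight $w_p^*(z^* )$ to the point $d$, is $D$-optimal in the Poisson–Gamma model on $\mathcal{X}$.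
   Context: $e_i$ denotes the $i$-th standard unit vector of $\mathbb{R}^{p-1}$ and $e_1$ in the information matrix formula denotes the first standard unit vector of $\mathbb{R}^p$. A design $\xi$ is a probability measure on $\mathcal{X}$ with finite support $x_1,\ldots,x_l$ and weights $w_1,\ldots,w_l\ge0$, $\sum_j w_j=1$. The Poisson information matrix is $M_{Po}(\xi;\beta)=\sum_{j=1}^l w_j\exp(f(x_j)^T\beta)f(x_j)f(x_j)^T$, and the Poisson–Gamma information matrix is $M(\xi;\beta)=\frac{a}{b}\Bigl(M_{Po}(\xi;\beta)-\frac{M_{Po}(\xi;\beta)e_1e_1^TM_{Po}(\xi;\beta)}{e_1^TM_{Po}(\xi;\beta)e_1+b/m}\Bigr)$. A design $\xi^*$ is $D$-optimal if $M(\xi^*;\beta)$ is regular and $\det M(\xi^*;\beta)\ge\det M(\xi;\beta)$ for all designs $\xi$ on $\mathcal{X}$. *)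

(* Defs.v *)
From HB Require Import structures.
From mathcomp Require Import all_boot all_order all_algebra.
From mathcomp Require Import reals.
From mathcomp.analysis Require Import sequences exp.
Set Implicit Arguments. Unset Strict Implicit. Unset Printing Implicit Defensive.
Import Order.TTheory GRing.Theory Num.Theory.
Local Open Scope ring_scope.

(* Dimension convention: p = 1 + n, the covariates x live in R^n = R^(p-1). *)

Record design (R : Type) (n : nat) := Design {
  dsize : nat;
  dpt : 'I_dsize -> 'cV[R]_n;
  dwt : 'I_dsize -> R }.
Arguments dsize {R n}.
Arguments dpt {R n}.
Arguments dwt {R n}.

Section PoissonGamma.
Variable R : realType.
Variable n : nat.

Definition regf (x : 'cV[R]_n) : 'cV[R]_(1 + n) := col_mx 1 x.

Definition linpred (beta : 'cV[R]_(1 + n)) (x : 'cV[R]_n) : R :=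
  ((regf x)^T *m beta) 0 0.

Definition e1 : 'cV[R]_(1 + n) := delta_mx (lshift n ord0) 0.

Definition betai (beta : 'cV[R]_(1 + n)) (i : 'I_n) : R := beta (rshift 1 i) 0.

Definition MPo (D : design R n) (beta : 'cV[R]_(1 + n)) : 'M[R]_(1 + n) :=
  \sum_(j < dsize D) (dwt D j * expR (linpred beta (dpt D j)))
      *: (regf (dpt D j) *m (regf (dpt D j))^T).

Definition MPG (a b : R) (m : nat) (D : design R n) (beta : 'cV[R]_(1 + n))
  : 'M[R]_(1 + n) :=
  let P := MPo D beta in
  (a / b) *: (P - ((e1^T *m P *m e1) 0 0 + b / m%:R)^-1 *: (P *m e1 *m e1^T *m P)).

Definition in_region (u v : 'cV[R]_n) (x : 'cV[R]_n) : Prop :=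
  forall i, u i 0 <= x i 0 <= v i 0.

Definition is_design_on (u v : 'cV[R]_n) (D : design R n) : Prop :=
  (forall j, 0 <= dwt D j) /\ \sum_(j < dsize D) dwt D j = 1 /\
  (forall j, in_region u v (dpt D j)).

Definition D_optimal (a b : R) (m : nat) (u v : 'cV[R]_n)
  (beta : 'cV[R]_(1 + n)) (D : design R n) : Prop :=
  is_design_on u v D /\
  \det (MPG a b m D beta) != 0 /\
  (forall D', is_design_on u v D' ->
     \det (MPG a b m D' beta) <= \det (MPG a b m D beta)).

Definition corner (beta : 'cV[R]_(1 + n)) (u v : 'cV[R]_n) : 'cV[R]_n :=
  \col_i (if 0 < betai beta i then v i 0 else u i 0).

Definition pR : R := (1 + n)%:R.

Definition wp_star (b : R) (m : nat) (beta : 'cV[R]_(1 + n)) (u v : 'cV[R]_n)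
  (z : R) : R :=
  let eta := linpred beta (corner beta u v) in
  2 / (pR + Num.sqrt ((pR - 2) ^+ 2 + 4 * (pR - 1) *
        ((1 + m%:R / b * expR eta) / (1 + m%:R / b * expR (eta - z))))).

Definition w1_star (b : R) (m : nat) (beta : 'cV[R]_(1 + n)) (u v : 'cV[R]_n)
  (z : R) : R := (1 - wp_star b m beta u v z) / (pR - 1).

Definition zeq (b : R) (m : nat) (beta : 'cV[R]_(1 + n)) (u v : 'cV[R]_n)
  (z : R) : R :=
  let eta := linpred beta (corner beta u v) in
  let w1 := w1_star b m beta u v z in
  let wp := wp_star b m beta u v z in
  m%:R * ((pR - 1) * w1 * expR (eta - z) + wp * expR eta)
       * (z * (pR - 1) * w1 - 2)
  + b * (z * pR * w1 - 2).

Definition xi_star (b : R) (m : nat) (beta : 'cV[R]_(1 + n)) (u v : 'cV[R]_n)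
  (z : R) : design R n :=
  let d := corner beta u v in
  @Design R n (1 + n)
    (fun k : 'I_(1 + n) => match split k with
       | inl _ => d
       | inr i => d - (z / betai beta i) *: delta_mx i 0
       end)
    (fun k : 'I_(1 + n) => match split k with
       | inl _ => wp_star b m beta u v z
       | inr _ => w1_star b m beta u v z
       end).

End PoissonGamma.

(* Main.v *)
Require Import Defs.
From HB Require Import structures.
From mathcomp Require Import all_boot all_order all_algebra.
From mathcomp Require Import reals.
From mathcomp.analysis Require Import sequences exp.
From mathcomp Require Import ring lra.
From mathcomp Require Import boolp topology normedtype derive realfun.
Import Order.TTheory GRing.Theory Num.Theory.
Import numFieldNormedType.Exports.
Set Implicit Arguments.
Unset Strict Implicit.
Unset Printing Implicit Defensive.
Local Open Scope ring_scope.

(* Put kappa = b/m and let c be the (1,1) entry of the Poisson information P.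
   The Poisson-Gamma information is a/b times the inverse of
   P^-1 + kappa^-1 e1 e1^T.  For positive semidefinite N and A of order k,
   det N det A <= (tr (N A) / k)^k (Cholesky, Hadamard, AM-GM); taking for N
   the inverse information of xi* shows that xi* is optimal as soon as its
   sensitivity function
     exp (f(x)^T beta) (f(x)^T P^-1 f(x) - 1 / (c + kappa))
   is at most p - c / (c + kappa) on the region.

   With y_i = beta_i (d_i - x_i) >= 0 and s = sum_i y_i, the vector f(x) has
   barycentric coordinates y_i / z and 1 - s / z with respect to the support of
   xi*, and sum_i y_i^2 <= s^2 reduces the bound to q(s) <= K exp s for s >= 0,
   with q a quadratic polynomial.  The formula for the weights makes both sides
   agree at s = 0 and s = z, and the equation for z makes them tangent at s = z,
   so the difference is K exp(t)/6 s (s - z)^2 for some t >= 0.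

   With A(z) = 1 + (m/b) exp (f(d)^T beta - z), the equation for z is equivalent
   to z (1 - w_p(z) (1 - 1/A(z))) = 2, whose left-hand side is continuous and
   strictly increasing, vanishes at 0 and is at least 2 at 4. *)

(** * Positive semidefinite matrices: Cholesky, Hadamard and a determinant-trace bound *)

Definition psdmx {R : numDomainType} {k : nat} (A : 'M[R]_k) : Prop :=
  A^T = A /\ forall x : 'cV_k, 0 <= (x^T *m A *m x) 0 0.

Lemma mx11E (R : comNzRingType) :
  ((forall A B : 'M[R]_1, (A + B) 0 0 = A 0 0 + B 0 0)
   * (forall A : 'M[R]_1, (- A) 0 0 = - A 0 0))
  * ((forall (s : R) (A : 'M[R]_1), (s *: A) 0 0 = s * A 0 0)
     * (forall A B : 'M[R]_1, (A *m B) 0 0 = A 0 0 * B 0 0)).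
Proof. by do !split=> *; rewrite !mxE ?big_ord1. Qed.

Lemma psdmx_congr (R : numDomainType) (k l : nat) (A : 'M[R]_k)
  (B : 'M_(k, l)) : psdmx A -> psdmx (B^T *m A *m B).
Proof.
case=> symA A_ge0; split=> [|x]; first by rewrite !trmx_mul trmxK symA mulmxA.
by have := A_ge0 (B *m x); rewrite trmx_mul !mulmxA.
Qed.

Lemma psdmx_mul_tr (R : realDomainType) (k l : nat) (B : 'M[R]_(k, l)) :
  psdmx (B *m B^T).
Proof.
split=> [|x]; first by rewrite trmx_mul trmxK.
rewrite mulmxA -mulmxA -[B^T *m x]trmxK trmx_mul trmxK mxE.
by apply: sumr_ge0 => i _; rewrite [_^T i 0]mxE -expr2 sqr_ge0.
Qed.

Lemma psdmxD (R : numDomainType) (k : nat) (A B : 'M[R]_k) :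
  psdmx A -> psdmx B -> psdmx (A + B).
Proof.
move=> [symA A_ge0] [symB B_ge0]; split=> [|x].
  by rewrite linearD /= symA symB.
by rewrite mulmxDr mulmxDl mxE addr_ge0.
Qed.

Lemma psdmxZ (R : numDomainType) (k : nat) (s : R) (A : 'M[R]_k) :
  0 <= s -> psdmx A -> psdmx (s *: A).
Proof.
move=> s_ge0 [symA A_ge0]; split=> [|x]; first by rewrite linearZ /= symA.
by rewrite -scalemxAr -scalemxAl mxE mulr_ge0.
Qed.

Lemma psdmx_diag_ge0 (R : numDomainType) (k : nat) (A : 'M[R]_k) (i : 'I_k) :
  psdmx A -> 0 <= A i i.
Proof.
by case=> _ /(_ (delta_mx i 0)); rewrite trmx_delta -rowE -colE !mxE.
Qed.

(** On the vectors with first entry s and tail the i-th unit vector, the form is affine in s with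
    slope 2 v_i; nonnegativity for every s forces the slope to vanish. *)
Lemma psdmx_block_corner0 (R : realFieldType) (k : nat) (v : 'rV[R]_k)
  (B : 'M_k) : psdmx (block_mx (0 : 'M_1) v v^T B) -> v = 0.
Proof.
case=> _ A_ge0; apply/rowP => i; rewrite mxE.
pose b := B i i.
have quad (s : R) : 0 <= 2 * s * v 0 i + b.
  have := A_ge0 (col_mx s%:M (delta_mx i 0)).
  rewrite tr_col_mx mul_row_block mul_row_col !mulmxDl tr_scalar_mx trmx_delta.
  rewrite mulmx0 mul0mx add0r -mulmxA -[delta_mx 0 i *m B *m _]mulmxA -!colE.
  rewrite -rowE mul_scalar_mx.
  by rewrite mul_mx_scalar -rowE !mxE /b; lra.
apply/eqP/negPn/negP => v_neq0.
have := quad (- (b + 1) / (2 * v 0 i)).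
rewrite (_ : _ + b = -1); first by rewrite lerNr oppr0 ler10.
by field.
Qed.

(** Induction through the Schur complement of the corner entry a, which is a congruence of A and
    hence semidefinite. If a = 0, then the rest of the first row vanishes too, and with the
    convention that 0 is its own inverse the same factor serves. *)
Lemma psdmx_cholesky (R : rcfType) (k : nat) (A : 'M[R]_k) :
  psdmx A -> exists2 L : 'M_k, is_trig_mx L & A = L *m L^T.
Proof.
elim: k A => [|k IHk] A psdA.
  by exists 0; [apply/is_trig_mxP => -[] | apply/matrixP => -[]].
move: psdA; rewrite -[k.+1]/(1 + k)%N in A *; rewrite -[A]submxK.
set v := ursubmx A; set B := drsubmx A; set a : 'M_1 := ulsubmx A => psdA.
have dlE : dlsubmx A = v^T.
  by case: psdA; rewrite tr_block_mx => /eq_block_mx[].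
move: psdA; rewrite dlE [a]mx11_scalar; move: (a 0 0) => {}a psdA.
have a_ge0 : 0 <= a.
  have := psdmx_diag_ge0 (lshift k 0) psdA.
  by rewrite block_mxEul mxE.
have psdS : psdmx (B - a^-1 *: (v^T *m v)).
  have [a0|a_neq0] := eqVneq a 0.
    have v0 : v = 0.
      by move: psdA; rewrite a0 raddf0; apply: psdmx_block_corner0.
    rewrite a0 v0 mulmx0 scaler0 subr0.
    have := psdmx_congr (col_mx 0 1%:M) psdA.
    rewrite tr_col_mx trmx0 trmx1 mul_row_block mul_row_col.
    by rewrite !mul0mx !mul1mx !add0r mulmx0 mulmx1 add0r.
  have := psdmx_congr (col_mx (- a^-1 *: v) 1%:M) psdA.
  rewrite tr_col_mx trmx1 mul_row_block mul_row_col !mulmx1 !mul1mx.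
  rewrite [(_ *: v)^T]linearZ /= -!scalemxAl mul_mx_scalar scalerA mulNr.
  by rewrite mulVf // scaleN1r addNr mul0mx add0r scaleNr addrC.
have [L trigL defS] := IHk _ psdS.
exists (block_mx (Num.sqrt a)%:M 0 ((Num.sqrt a)^-1 *: v^T) L).
  by rewrite is_trig_block_mx // scalar_mx_is_trig eqxx trigL.
rewrite tr_block_mx mulmx_block !trmx0 !mul0mx !mulmx0 !addr0 -defS.
rewrite tr_scalar_mx -scalar_mxM -expr2 sqr_sqrtr // linearZ /= trmxK.
rewrite mul_scalar_mx mul_mx_scalar !scalerA -scalemxAl -scalemxAr scalerA.
rewrite -expr2 exprVn sqr_sqrtr // [a^-1 *: _ + _]addrC subrK.
have [a0|a_neq0] := eqVneq a 0.
  have v0 : v = 0 by move: psdA; rewrite a0 raddf0; apply: psdmx_block_corner0.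
  by rewrite v0 trmx0 !scaler0.
by rewrite mulfV ?sqrtr_eq0 -?ltNge ?lt_def ?a_neq0 // !scale1r.
Qed.

(** In a Cholesky factorization the determinant is the product of the L_ii^2, and A_ii is L_ii^2
    plus further squares. *)
Lemma hadamard_psdmx (R : rcfType) (k : nat) (A : 'M[R]_k) :
  psdmx A -> \det A <= \prod_i A i i.
Proof.
case/psdmx_cholesky=> L trigL ->.
rewrite det_mulmx det_tr det_trig // -big_split /=.
apply: ler_prod => i _; rewrite -expr2 sqr_ge0 /= mxE (bigD1 i) //= mxE -expr2.
by rewrite lerDl sumr_ge0 // => j _; rewrite mxE -expr2 sqr_ge0.
Qed.

(** With N = L L^T, the semidefinite matrix L^T A L has determinant det N det A and trace tr (N A);
    Hadamard and AM-GM apply to its diagonal. *)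
Lemma det_mul_psdmx_le (R : rcfType) (k : nat) (N A : 'M[R]_k) :
  psdmx N -> psdmx A -> \det N * \det A <= (\tr (N *m A) / k%:R) ^+ k.
Proof.
case/psdmx_cholesky=> L _ -> psdA.
have psdB := psdmx_congr L psdA.
have -> : \det (L *m L^T) * \det A = \det (L^T *m A *m L).
  by rewrite !det_mulmx det_tr; ring.
rewrite -(mulmxA L) (mxtrace_mulC L).
apply: le_trans (hadamard_psdmx psdB) _.
have := @leif_AGM R 'I_k predT (fun i => (L^T *m A *m L) i i).
rewrite card_ord; case=> [i _|+ _]; first exact: psdmx_diag_ge0.
by [].
Qed.

(** * The Poisson-Gamma information as a function of the Poisson information *)

(** Stated without inverting P, so that it also covers competing designs with singular
    information. *)
Definition pg_info {R : fieldType} {k : nat} (kap : R) (e : 'cV[R]_k)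
  (P : 'M[R]_k) : 'M[R]_k :=
  P - ((e^T *m P *m e) 0 0 + kap)^-1 *: (P *m e *m e^T *m P).

(** Completing the square: the form at x is that of P at x - s e plus kap s^2, for the multiple s
    chosen in the proof. *)
Lemma psdmx_pg_info (R : realFieldType) (k : nat) (kap : R) (e : 'cV[R]_k)
  (P : 'M[R]_k) : 0 < kap -> psdmx P -> psdmx (pg_info kap e P).
Proof.
move=> kap_gt0 psdP; have [symP P_ge0] := psdP.
have c_ge0 := P_ge0 e; rewrite /pg_info; set c := (_ *m e) 0 0 in c_ge0 *.
split=> [|x].
  by rewrite linearB linearZ /= !trmx_mul trmxK symP !mulmxA.
have ck_gt0 : 0 < c + kap by rewrite ltr_wpDl.
set s := (e^T *m P *m x) 0 0 / (c + kap).
have exE : (x^T *m P *m e) 0 0 = (e^T *m P *m x) 0 0.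
  have -> : e^T *m P *m x = (x^T *m P *m e)^T.
    by rewrite !trmx_mul trmxK symP mulmxA.
  by rewrite [RHS]mxE.
have -> : (x^T *m (P - (c + kap)^-1 *: (P *m e *m e^T *m P)) *m x) 0 0
   = ((x - s *: e)^T *m P *m (x - s *: e)) 0 0 + kap * s ^+ 2.
  rewrite (_ : (x - _)^T = x^T - s *: e^T); last by rewrite linearB linearZ.
  rewrite !(mulmxBl, mulmxBr) -!(scalemxAl, scalemxAr).
  have -> : x^T *m (P *m e *m e^T *m P) *m x
     = (x^T *m P *m e) *m (e^T *m P *m x) by rewrite !mulmxA.
  rewrite !mx11E exE -/c /s.
  move: ((e^T *m P *m x) 0 0) => t.
  by field; rewrite gt_eqF.
by rewrite addr_ge0 ?P_ge0 // mulr_ge0 ?sqr_ge0 // ltW.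
Qed.

(** The Sherman-Morrison formula. *)
Lemma pg_info_inv (R : fieldType) (k : nat) (kap : R) (e : 'cV[R]_k)
  (P : 'M[R]_k) :
  P \in unitmx -> kap != 0 -> (e^T *m P *m e) 0 0 + kap != 0 ->
  (invmx P + kap^-1 *: (e *m e^T)) *m pg_info kap e P = 1%:M.
Proof.
move=> unitP kap0; rewrite /pg_info; set c := (_ *m e) 0 0 => ck0.
rewrite mulmxDl !mulmxBr mulVmx // -!(scalemxAl, scalemxAr) !mulmxA mulVmx //.
rewrite mul1mx.
have -> : e *m e^T *m P *m e *m e^T *m P = c *: (e *m e^T *m P).
  rewrite -!(mulmxA e) [e^T *m P *m e]mx11_scalar -/c.
  by rewrite -!(mulmxA c%:M) mul_scalar_mx -scalemxAr !mulmxA.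
rewrite !scalerA -addrA -[RHS]addr0; congr (_ + _).
rewrite -scaleNr -scalerBl -scalerDl.
rewrite (_ : _ + _ = 0) ?scale0r //.
by field; rewrite ck0 kap0.
Qed.

(* Writing [c0] and [c] for the quadratic forms of [P0] and [P] at [e], the
   hypothesis on the trace says that the derivative of
   [log (\det P / (c + kap))] at [P0] in the direction [P - P0] is
   nonpositive. *)
Lemma det_pg_info_le (R : rcfType) (k : nat) (kap : R) (e : 'cV[R]_k)
  (P0 P : 'M[R]_k) (c0 := (e^T *m P0 *m e) 0 0) (c := (e^T *m P *m e) 0 0) :
  0 < kap -> psdmx P0 -> P0 \in unitmx -> psdmx P ->
  \tr (invmx P0 *m P) + (c0 - c) / (c0 + kap) <= k%:R ->
  0 < \det (pg_info kap e P0) /\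
  \det (pg_info kap e P) <= \det (pg_info kap e P0).
Proof.
move=> kap_gt0 psdP0 unitP0 psdP le_k.
have [[symP0 P0_ge0] [symP P_ge0]] := (psdP0, psdP).
have c0k_gt0 : 0 < c0 + kap by rewrite ltr_wpDl // P0_ge0.
have ck_gt0 : 0 < c + kap by rewrite ltr_wpDl // P_ge0.
have psdV : psdmx (invmx P0).
  have := psdmx_congr (invmx P0) psdP0.
  by rewrite trmx_inv symP0 mulVmx // mul1mx.
pose N := invmx P0 + kap^-1 *: (e *m e^T).
have psdN : psdmx N.
  apply: psdmxD => //; apply: psdmxZ; last exact: psdmx_mul_tr.
  by rewrite invr_ge0 ltW.
have NP0 := pg_info_inv unitP0 (lt0r_neq0 kap_gt0) (lt0r_neq0 c0k_gt0).
have detNP0 : \det N * \det (pg_info kap e P0) = 1.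
  by rewrite -det_mulmx NP0 det1.
have detP0_gt0 : 0 < \det (pg_info kap e P0).
  have : 0 <= \det (pg_info kap e P0).
    have [L _ ->] := psdmx_cholesky (psdmx_pg_info e kap_gt0 psdP0).
    by rewrite det_mulmx det_tr -expr2 sqr_ge0.
  rewrite le_eqVlt => /predU1P[det0|//].
  by move/eqP: detNP0; rewrite -det0 mulr0 eq_sym oner_eq0.
have detN_gt0 : 0 < \det N by rewrite -(pmulr_lgt0 _ detP0_gt0) detNP0.
split=> //; rewrite -(ler_pM2l detN_gt0) detNP0.
have psdQ := psdmx_pg_info e kap_gt0 psdP.
apply: le_trans (det_mul_psdmx_le psdN psdQ) _.
have tr_ge0 : 0 <= \tr (N *m pg_info kap e P).
  have [L _ ->] := psdmx_cholesky psdN.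
  rewrite -mulmxA mxtrace_mulC; apply: sumr_ge0 => i _.
  exact/psdmx_diag_ge0/psdmx_congr.
suff tr_le : \tr (N *m pg_info kap e P) <= k%:R.
  rewrite exprn_ile1 ?divr_ge0 //.
  (* For k = 0 the quotient is 0 by the convention on division by zero. *)
  have [->|k_neq0] := eqVneq (k%:R : R) 0; first by rewrite invr0 mulr0.
  by rewrite ler_pdivrMr ?mul1r // lt_def k_neq0 ler0n.
pose y := P *m e; pose q := (y^T *m invmx P0 *m y) 0 0.
have yT : y^T = e^T *m P by rewrite trmx_mul symP.
have trB (X Y : 'M[R]_k) : \tr (X - Y) = \tr X - \tr Y by rewrite linearB.
have trE : \tr (N *m pg_info kap e P)
   = \tr (invmx P0 *m P) + c / kap - (c + kap)^-1 * (q + c ^+ 2 / kap).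
  rewrite /pg_info -/c -/y -mulmxA -yT mulmxDl !mulmxBr -!scalemxAr -!scalemxAl.
  rewrite !(trB, mxtraceD, mxtraceZ) !mulmxA -(mulmxA e) -yT.
  do 3!rewrite (mxtrace_mulC _ y^T).
  rewrite !trace_mx11.
  rewrite -(mulmxA _ P e) -/y [y^T *m (invmx P0 *m y)]mulmxA -/q.
  rewrite -(mulmxA e) (mulmxA y^T e) mx11E (_ : (y^T *m e) 0 0 = c) ?yT //.
  by field; rewrite !gt_eqF.
(* The form of P0^-1 at y - t P0 e is nonnegative, which bounds q below. This value of t turns what
   remains of the trace inequality into a nonnegative multiple of a square. *)
pose t := (c + kap) / (c0 + kap).
have q_ge : 2 * t * c - t ^+ 2 * c0 <= q.
  case: psdV => symV /(_ (y - t *: (P0 *m e))).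
  rewrite (_ : (y - _)^T = y^T - t *: (e^T *m P0)); last first.
    by rewrite -[in RHS]symP0 -trmx_mul linearB linearZ.
  rewrite !(mulmxBl, mulmxBr) -!(scalemxAl, scalemxAr) !mulmxA mulmxKV //.
  rewrite !mulmxK // -(mulmxA _ P e) -/y !mx11E -/q yT -/c -/c0.
  by move=> ?; nra.
rewrite {}trE; apply: le_trans le_k; rewrite -subr_ge0.
have -> : \tr (invmx P0 *m P) + (c0 - c) / (c0 + kap)
  - (\tr (invmx P0 *m P) + c / kap - (c + kap)^-1 * (q + c ^+ 2 / kap))
  = (q - (2 * t * c - t ^+ 2 * c0)) / (c + kap)
    + kap / (c + kap) * ((c0 - c) / (c0 + kap)) ^+ 2.
  by rewrite /t; field; rewrite !gt_eqF.
apply: addr_ge0; first by rewrite divr_ge0 ?subr_ge0 // ltW.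
by rewrite mulr_ge0 ?sqr_ge0 // divr_ge0 // ltW.
Qed.

(** * Inequalities for the exponential function *)

Lemma is_derive_ge0_le (R : realType) (f df : R -> R) (a b : R) :
  a <= b -> (forall x, a <= x <= b -> is_derive x 1 f (df x)) ->
  (forall x, a <= x <= b -> 0 <= df x) -> f a <= f b.
Proof.
move=> le_ab f_df df_ge0; rewrite -subr_ge0.
have [x||c] := @MVT_segment R f df a b le_ab.
- by rewrite in_itv /= => /andP[ax xb]; apply: f_df; rewrite !ltW.
- apply: derivable_within_continuous => x.
  by rewrite in_itv /= => /f_df [].
by rewrite in_itv /= => /df_ge0 df_c ->; rewrite mulr_ge0 // subr_ge0.
Qed.

Lemma expR_Taylor2_mono (R : realType) (x y : R) : x <= y ->
  expR x - 1 - x - x ^+ 2 / 2 <= expR y - 1 - y - y ^+ 2 / 2.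
Proof.
move=> le_xy.
apply: (is_derive_ge0_le (f := fun t => expR t - 1 - t - t ^+ 2 / 2)
  (df := fun t => expR t - (1 + t)) le_xy) => t _.
  by apply: is_derive_eq; rewrite /GRing.scale /=; lra.
by rewrite subr_ge0 expR_ge1Dx.
Qed.

(** This is the numerator of the derivative of (exp x - 1 - x) / x^2. It vanishes at 0 and is
    nondecreasing, because exp (-t) >= 1 - t. *)
Lemma expR_remainder_le0 (R : realType) (x : R) : x <= 0 ->
  (x - 2) * expR x + x + 2 <= 0.
Proof.
move=> x_le0.
have := is_derive_ge0_le (f := fun t => (t - 2) * expR t + t + 2)
  (df := fun t => (t - 1) * expR t + 1) x_le0.
rewrite expR0 (_ : (0 - 2) * 1 + 0 + 2 = 0); last by ring.
apply=> t _.
  by apply: is_derive_eq; rewrite /GRing.scale /=; lra.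
have := expR_ge1Dx (- t); rewrite -(ler_pM2r (expR_gt0 t)) -expRD addNr expR0.
lra.
Qed.

Lemma expR_remainder_ratio_le (R : realType) (x y : R) : x <= y -> y < 0 ->
  (expR x - 1 - x) / x ^+ 2 <= (expR y - 1 - y) / y ^+ 2.
Proof.
move=> le_xy y_lt0.
apply: (is_derive_ge0_le (f := fun t => (expR t - 1 - t) * (t ^+ 2)^-1)
  (df := fun t => ((t - 2) * expR t + t + 2) / t ^+ 3) le_xy)
  => t /andP[_ le_ty].
  have t_neq0 : t != 0 by rewrite lt_eqF // (le_lt_trans le_ty).
  have t2_neq0 : t ^+ 2 != 0 by rewrite expf_neq0.
  by apply: is_derive_eq; rewrite /GRing.scale /=; field.
have t_lt0 : t < 0 by rewrite (le_lt_trans le_ty).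
rewrite mulr_le0 ?expR_remainder_le0 ?invr_le0 ?(ltW t_lt0) //.
by rewrite exprS mulr_le0_ge0 ?sqr_ge0 // ltW.
Qed.

(* [(expR x - 1 - x) / x ^+ 2] is nondecreasing on both sides of 0, and 1/2
   separates its negative side from its positive side. *)
Lemma expR_remainder_cross_le (R : realType) (z r : R) : 0 < z -> - z <= r ->
  r ^+ 2 * (expR (- z) - 1 + z) <= z ^+ 2 * (expR r - 1 - r).
Proof.
move=> z_gt0 ge_r.
have [r_ge0|r_lt0] := leP 0 r.
  have := expR_Taylor2_mono r_ge0.
  have := @expR_Taylor2_mono R (- z) 0.
  rewrite oppr_le0 (ltW z_gt0) expR0 => /(_ isT) Hz Hr.
  have {}Hz : expR (- z) - 1 + z <= z ^+ 2 / 2 by nra.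
  have {}Hr : r ^+ 2 / 2 <= expR r - 1 - r by nra.
  have := ler_wpM2l (sqr_ge0 r) Hz; have := ler_wpM2l (sqr_ge0 z) Hr.
  by move=> *; nra.
have := expR_remainder_ratio_le ge_r r_lt0.
rewrite sqrrN opprK ler_pdivrMr ?exprn_gt0 // mulrAC.
have r2 : 0 < r ^+ 2 by rewrite exprn_even_gt0 //= lt_eqF.
by rewrite ler_pdivlMr // [_ * r ^+ 2]mulrC [(z ^+ 2 * _)%R]mulrC.
Qed.

(* The left-hand side is the quadratic polynomial in [s] that interpolates
   [K * expR s] at 0 and, to second order, at [z]. *)
Lemma quad_interp_le_expR (R : realType) (z K A B C s : R) :
  0 < z -> 0 <= K -> B - C = K -> A * z ^+ 2 - C = K * expR z ->
  2 * A * z = K * expR z -> 0 <= s ->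
  A * s ^+ 2 + B * (1 - s / z) ^+ 2 - C <= K * expR s.
Proof.
move=> z_gt0 K_ge0 KE at_z slope_z s_ge0.
have ge_r : - z <= s - z by lra.
(* Taken at r = s - z and multiplied by K exp z, the remainder inequality becomes z^2 times the
   claim once the interpolation conditions eliminate C and exp z. *)
have := ler_wpM2l (mulr_ge0 K_ge0 (expR_ge0 z))
  (expR_remainder_cross_le z_gt0 ge_r).
have -> : K * expR z * ((s - z) ^+ 2 * (expR (- z) - 1 + z))
   = (s - z) ^+ 2 * (K - K * expR z + z * (K * expR z)).
  by rewrite expRN; field; rewrite gt_eqF ?expR_gt0.
have -> : K * expR z * (z ^+ 2 * (expR (s - z) - 1 - (s - z)))
   = z ^+ 2 * (K * expR s - K * expR z * (1 + s - z)).
  by rewrite expRD expRN; field; rewrite gt_eqF ?expR_gt0.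
rewrite -slope_z.
have -> : K = B - (A * z ^+ 2 - 2 * A * z) by rewrite -KE slope_z -at_z; ring.
set K' := B - _ => le_z2; rewrite -(ler_pM2l (exprn_gt0 2 z_gt0)).
have CE : C = A * z ^+ 2 - 2 * A * z by rewrite slope_z -at_z; ring.
rewrite -subr_ge0 in le_z2; rewrite -subr_ge0; apply: le_trans le_z2 _.
rewrite le_eqVlt; apply/orP; left; apply/eqP; rewrite CE /K'; field.
by rewrite gt_eqF.
Qed.

(** * The weights of xi* and the equation for z *)

(** The formula is a rationalized root of the quadratic equation in the conclusion. As r >= 1, the
    radicand is at least p^2, whence p wp <= 1. *)
Lemma D_weights (R : rcfType) (p r wp : R) : 2 <= p -> 1 <= r ->
  wp = 2 / (p + Num.sqrt ((p - 2) ^+ 2 + 4 * (p - 1) * r)) ->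
  [/\ 0 < wp, p * wp <= 1
    & (1 - wp) * (1 - (p - 1) * wp) = (p - 1) * r * wp ^+ 2].
Proof.
move=> p_ge2 r_ge1 ->; set d := (p - 2) ^+ 2 + _.
have d_ge : p ^+ 2 <= d by rewrite /d; nra.
have dE : Num.sqrt d ^+ 2 = d.
  by rewrite sqr_sqrtr // (le_trans (sqr_ge0 p)).
have p_le : p <= Num.sqrt d.
  by rewrite -(ler_sqr (_ : p \in Num.nneg)) ?nnegrE ?sqrtr_ge0 ?dE //; lra.
have s_gt0 : 0 < p + Num.sqrt d by lra.
split; first by rewrite divr_gt0.
  by rewrite mulrA ler_pdivrMr //; lra.
move: dE s_gt0; rewrite /d; move: (Num.sqrt _) => s sE s_gt0.
have rE : (p - 1) * r = (s ^+ 2 - (p - 2) ^+ 2) / 4 by rewrite sE; field.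
by rewrite rE; field; rewrite gt_eqF.
Qed.

Section DWeights.
Variables (R : realType) (n m : nat) (b : R) (beta : 'cV[R]_(1 + n)).
Variables (u v : 'cV[R]_n).
Hypotheses (n_gt0 : (0 < n)%N) (m_gt0 : (0 < m)%N) (b_gt0 : 0 < b).

Local Notation N := (n%:R : R).
Local Notation eta := (linpred beta (corner beta u v)).
Local Notation wp := (wp_star b m beta u v).
Local Notation w1 := (w1_star b m beta u v).

(** The function A of the overview; the weights depend on z only through [alpha 0 / alpha z]. *)
Definition alpha (z : R) : R := 1 + m%:R / b * expR (eta - z).

Lemma pRE : pR R n = N + 1.
Proof. by rewrite /pR natrD addrC. Qed.

Lemma N_ge1 : 1 <= N.
Proof. by rewrite ler1n. Qed.

Lemma rho_gt0 : 0 < m%:R / b :> R.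
Proof. by rewrite divr_gt0 ?ltr0n. Qed.

Lemma alpha_gt1 (z : R) : 1 < alpha z.
Proof. by rewrite ltrDl mulr_gt0 ?rho_gt0 ?expR_gt0. Qed.

Lemma alpha_gt0 (z : R) : 0 < alpha z.
Proof. exact: lt_trans ltr01 (alpha_gt1 z). Qed.

Lemma alpha_le (x y : R) : x <= y -> alpha y <= alpha x.
Proof.
by move=> le_xy; rewrite lerD2l ler_pM2l ?rho_gt0 // ler_expR lerD2l lerN2.
Qed.

Lemma wp_starE (z : R) :
  wp z = 2 / (pR R n + Num.sqrt ((pR R n - 2) ^+ 2
                + 4 * (pR R n - 1) * (alpha 0 / alpha z))).
Proof. by rewrite /wp_star /alpha subr0. Qed.

Lemma D_weights_star (z : R) : 0 <= z ->
  [/\ 0 < wp z, pR R n * wp z <= 1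
    & (1 - wp z) * (1 - N * wp z) = N * (alpha 0 / alpha z) * wp z ^+ 2].
Proof.
move=> z_ge0; have := @D_weights R (pR R n) (alpha 0 / alpha z) (wp z).
rewrite pRE addrK; apply; first by have := N_ge1; lra.
  by rewrite ler_pdivlMr ?alpha_gt0 // mul1r alpha_le.
by rewrite wp_starE pRE addrK.
Qed.

Lemma w1_starE (z : R) : N * w1 z = 1 - wp z.
Proof. by rewrite /w1_star pRE; field; have := N_ge1; lra. Qed.

Lemma w1_star_gt0 (z : R) : 0 <= z -> 0 < w1 z.
Proof.
case/D_weights_star; rewrite pRE => wp_gt0 pwp_le1 _.
have N_gt0 : 0 < N by rewrite ltr0n.
by rewrite -(pmulr_rgt0 _ N_gt0) w1_starE; nra.
Qed.

(* [b] times this is [m (c + b/m)], where [c] is the Poisson information of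
   the intercept. *)
Definition wavg (z : R) : R := wp z * alpha 0 + N * w1 z * alpha z.

Lemma wavg_gt0 (z : R) : 0 <= z -> 0 < wavg z.
Proof.
move=> z_ge0; have [wp_gt0 _ _] := D_weights_star z_ge0.
apply: addr_gt0; apply: mulr_gt0 => //; try exact: alpha_gt0.
by apply: mulr_gt0; [rewrite ltr0n | exact: w1_star_gt0].
Qed.

(** The quadratic equation of [D_weights] in product form; it serves to eliminate [w1 z] and n from
    later identities. *)
Lemma w1_alpha (z : R) : 0 <= z -> w1 z * alpha z = wp z * wavg z.
Proof.
move=> z_ge0; have [_ _ wpE] := D_weights_star z_ge0.
have N_neq0 : N != 0 by rewrite pnatr_eq0 -lt0n.
have a_neq0 : alpha z != 0 by rewrite gt_eqF ?alpha_gt0.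
apply: (mulfI N_neq0); rewrite mulrA w1_starE /wavg w1_starE.
have : (1 - wp z) * (1 - N * wp z) * alpha z = N * alpha 0 * wp z ^+ 2.
  by rewrite wpE; field.
move: (alpha z) (alpha 0) (wp z) => A2 A1 w; lra.
Qed.

Definition zfun (z : R) : R := z * (1 - wp z * (1 - (alpha z)^-1)).

(** Both exponentials are affine in values of [alpha], and [w1_alpha] absorbs the extra term b z w1.
    The factor before [zfun z - 2] is positive, so only [zfun] matters for the roots. *)
Lemma zeq_factor (z : R) : 0 <= z ->
  zeq b m beta u v z = b * wavg z * (zfun z - 2).
Proof.
move=> z_ge0; rewrite /zeq /= pRE addrK /zfun.
have a_neq0 : alpha z != 0 by rewrite gt_eqF ?alpha_gt0.
have rho_neq0 : m%:R != 0 :> R by rewrite pnatr_eq0 -lt0n.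
have b_neq0 : b != 0 by rewrite gt_eqF.
have E2E : expR (eta - z) = (alpha z - 1) * (b / m%:R).
  by rewrite /alpha; field; rewrite rho_neq0 b_neq0.
have E1E : expR eta = (alpha 0 - 1) * (b / m%:R).
  by rewrite /alpha subr0; field; rewrite rho_neq0 b_neq0.
have w1E : w1 z = wp z * wavg z / alpha z.
  by rewrite -w1_alpha // mulfK.
have -> : b * wavg z * (z * (1 - wp z * (1 - (alpha z)^-1)) - 2)
  = b * wavg z * (z * (1 - wp z) - 2) + b * z * w1 z by rewrite w1E; field.
rewrite -w1_starE E1E E2E /wavg.
have : N * w1 z + wp z = 1 by rewrite w1_starE subrK.
move: (w1 z) (wp z) (alpha z) (alpha 0) a_neq0 {E1E E2E w1E} => x y A2 A1 _ xy1.
have -> : y = 1 - N * x by lra.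
by field.
Qed.

Lemma zeq_root (z : R) : 0 <= z ->
  zeq b m beta u v z = 0 <-> zfun z = 2.
Proof.
move=> z_ge0; rewrite zeq_factor //.
split=> [/eqP|->]; last by rewrite subrr mulr0.
by rewrite mulf_eq0 (gt_eqF (mulr_gt0 b_gt0 (wavg_gt0 z_ge0))) subr_eq0 => /eqP.
Qed.

(** As z grows, [alpha z] decreases, so both [wp z] and 1 - 1 / [alpha z] decrease weakly. The
    bracket in [zfun] is therefore nondecreasing, and it is positive. *)
Lemma zfun_lt (x y : R) : 0 <= x -> x < y -> zfun x < zfun y.
Proof.
move=> x_ge0 lt_xy; have y_ge0 : 0 <= y by rewrite (le_trans x_ge0) ?ltW.
have [wx_gt0 wx_le _] := D_weights_star x_ge0.
have [wy_gt0 _ _] := D_weights_star y_ge0.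
have le_a := alpha_le (ltW lt_xy).
have [ax_gt0 ay_gt0] := (alpha_gt0 x, alpha_gt0 y).
have le_w : wp y <= wp x.
  have p_gt0 : 0 < pR R n by rewrite pRE ltr_wpDl ?ler0n.
  rewrite !wp_starE ler_pM2l // lef_pV2 ?posrE ?ltr_wpDr ?sqrtr_ge0 //.
  rewrite pRE addrK.
  rewrite lerD2l ler_wsqrtr // lerD2l ler_wpM2l //; first by have := N_ge1; lra.
  by rewrite ler_wpM2l ?(ltW (alpha_gt0 _)) // lef_pV2 ?posrE.
have le_V : (alpha x)^-1 <= (alpha y)^-1 by rewrite lef_pV2 ?posrE.
have V_le1 : (alpha y)^-1 <= 1 by rewrite invf_le1 // ltW ?alpha_gt1.
have V_gt0 : 0 < (alpha x)^-1 by rewrite invr_gt0.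
have le_U : wp y * (1 - (alpha y)^-1) <= wp x * (1 - (alpha x)^-1).
  by rewrite ler_pM //; lra.
have U_lt1 : wp x * (1 - (alpha x)^-1) < 1.
  by have := N_ge1; rewrite pRE in wx_le; nra.
rewrite /zfun; nra.
Qed.

Lemma continuous_zfun : continuous zfun.
Proof.
have calpha : continuous alpha.
  move=> x; apply: cvgD; first exact: cvg_cst.
  apply: cvgM; first exact: cvg_cst.
  apply: (continuous_comp (f := fun z => eta - z)); last exact: continuous_expR.
  by apply: cvgB; [exact: cvg_cst | exact: cvg_id].
have cV : continuous (fun z => (alpha z)^-1).
  by move=> x; apply: cvgV; [rewrite gt_eqF ?alpha_gt0 | exact: calpha].
move=> x; apply: cvgM; first exact: cvg_id.
apply: cvgB; first exact: cvg_cst.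
apply: cvgM; last by apply: cvgB; [exact: cvg_cst | exact: cV].
have wpE : wp = fun z => 2 / (pR R n + Num.sqrt ((pR R n - 2) ^+ 2
                              + 4 * (pR R n - 1) * (alpha 0 / alpha z))).
  by apply/funext => z; exact: wp_starE.
suff : continuous wp by exact.
rewrite wpE => {}x; apply: cvgM; first exact: cvg_cst.
apply: cvgV.
  by rewrite gt_eqF // ltr_wpDr ?sqrtr_ge0 // pRE addr_gt0 // ltr0n.
apply: cvgD; first exact: cvg_cst.
apply: (continuous_comp (f := fun z => _ + _ * (alpha 0 / alpha z)));
  last exact: sqrt_continuous.
apply: cvgD; first exact: cvg_cst.
apply: cvgM; first exact: cvg_cst.
by apply: cvgM; [exact: cvg_cst | exact: cV].
Qed.

Lemma zeq_unique_root : exists! z : R, 0 < z /\ zeq b m beta u v z = 0.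
Proof.
have zfun0 : zfun 0 = 0 by rewrite /zfun mul0r.
have zfun4 : 2 <= zfun 4.
  have [w_gt0 w_le _] := D_weights_star (z := 4) (ler0n _ _).
  have V_le1 : (alpha 4)^-1 <= 1.
    by rewrite invf_le1 ?alpha_gt0 // ltW ?alpha_gt1.
  have V_gt0 : 0 < (alpha 4)^-1 by rewrite invr_gt0 alpha_gt0.
  by rewrite /zfun; have := N_ge1; rewrite pRE in w_le; nra.
have [|||z] := @IVT R zfun 0 4 2.
- exact: ler0n.
- exact/continuous_subspaceT/continuous_zfun.
- by rewrite zfun0 ge_min le_max zfun4 ler0n orbT.
rewrite in_itv /= => /andP[z_ge0 _] zE.
exists z; split=> [|y [y_gt0 /(zeq_root (ltW y_gt0)) yE]].
  split; last exact/zeq_root.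
  rewrite lt_def z_ge0 andbT; apply/eqP => z0.
  by move: zE; rewrite z0 zfun0 => /eqP; rewrite eq_sym pnatr_eq0.
have [lt_zy|lt_yz|//] := ltgtP z y.
- by have := zfun_lt z_ge0 lt_zy; rewrite zE yE ltxx.
- by have := zfun_lt (ltW y_gt0) lt_yz; rewrite zE yE ltxx.
Qed.

(** The sensitivity bound after the variance has been replaced by its majorant in the total slack s.
    Multiplied by exp s, it is an instance of [quad_interp_le_expR]. *)
Lemma sensitivity_star_le (z s : R) (kap := b / m%:R : R)
  (o1 := w1 z * expR (eta - z)) (op := wp z * expR eta)
  (c := N * o1 + op) :
  0 < z -> zeq b m beta u v z = 0 -> 0 <= s ->
  expR (eta - s) * ((s / z) ^+ 2 / o1 + (1 - s / z) ^+ 2 / op - (c + kap)^-1)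
    <= (1 + n)%:R - c / (c + kap).
Proof.
move=> z_gt0 /(zeq_root (ltW z_gt0)) zE s_ge0.
have z_ge0 := ltW z_gt0.
have [wp_gt0 _ _] := D_weights_star z_ge0.
have [w1_gt0 a_gt0] := (w1_star_gt0 z_ge0, alpha_gt0 z).
have wavg_gt0 := wavg_gt0 z_ge0.
have m_neq0 : m%:R != 0 :> R by rewrite pnatr_eq0 -lt0n.
have b_neq0 : b != 0 by rewrite gt_eqF.
have [[E_gt0 Ez_gt0] Es_gt0] := (expR_gt0 eta, expR_gt0 z, expR_gt0 s).
have w1E : w1 z = wp z * wavg z / alpha z.
  by rewrite -w1_alpha // mulfK // gt_eqF.
have NwE : N * w1 z = 1 - wp z by exact: w1_starE.
have SE : wavg z = wp z * alpha 0 + (1 - wp z) * alpha z by rewrite /wavg NwE.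
have ckE : c + kap = kap * wavg z.
  rewrite /c /o1 /op mulrA NwE SE /alpha subr0 /kap.
  by field; rewrite m_neq0 b_neq0.
have kap_gt0 : 0 < kap by rewrite divr_gt0 ?ltr0n.
have EE : expR eta = (alpha 0 - 1) * kap.
  by rewrite /alpha subr0 /kap; field; rewrite m_neq0 b_neq0.
have EzE : expR (eta - z) = (alpha z - 1) * kap.
  by rewrite /alpha /kap; field; rewrite m_neq0 b_neq0.
pose K := N + (wavg z)^-1.
have KE : (1 + n)%:R - c / (c + kap) = K.
  have -> : c = kap * wavg z - kap by rewrite -ckE addrK.
  by rewrite subrK natrD /K; field; rewrite !gt_eqF.
have K_ge0 : 0 <= K by rewrite addr_ge0 ?ler0n // invr_ge0 ltW.
have NE : N = (1 - wp z) * alpha z / (wp z * wavg z).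
  by rewrite -w1_alpha // -NwE -(mulrA N) mulfK // gt_eqF // mulr_gt0.
have le_K := @quad_interp_le_expR R z K (expR z / (w1 z * z ^+ 2)) (wp z)^-1
  (expR eta / (c + kap)) s z_gt0 K_ge0 _ _ _ s_ge0.
rewrite KE -(ler_pM2r Es_gt0).
apply: le_trans (le_K _ _ _).
- rewrite /o1 /op !expRB le_eqVlt; apply/orP; left; apply/eqP.
  rewrite {le_K}ckE; field.
  by rewrite !gt_eqF.
(* Agreement at s = 0, from the equation for the weights. *)
- have A1E : alpha 0 = (wavg z - (1 - wp z) * alpha z) / wp z.
    by rewrite SE addrK mulrAC mulfV ?mul1r // gt_eqF.
  rewrite ckE EE /K NE A1E; field.
  by rewrite !gt_eqF.
(* Agreement at s = z, again from the weights. *)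
- have -> : expR eta = (alpha z - 1) * kap * expR z.
    by rewrite -EzE -expRD subrK.
  rewrite ckE /K NE w1E; field.
  by rewrite !gt_eqF.
(* Tangency at s = z: here the equation for z enters, its root property replacing the constant 2. *)
- rewrite -zE /zfun /K NE w1E; field.
  by rewrite !gt_eqF.
Qed.
End DWeights.

(** * Information matrices of designs and the sensitivity criterion *)

Lemma MPGE (R : realType) (n m : nat) (a b : R) (D : design R n)
  (beta : 'cV[R]_(1 + n)) :
  MPG a b m D beta = (a / b) *: pg_info (b / m%:R) (e1 R n) (MPo D beta).
Proof. by []. Qed.

Lemma mul_e1_regf (R : realType) (n : nat) (x : 'cV[R]_n) :
  (e1 R n)^T *m regf x = 1%:M.
Proof.
rewrite /e1 /regf trmx_delta -rowE; apply/matrixP => i j.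
by rewrite mxE col_mxEu !ord1.
Qed.

Lemma MPo_intercept (R : realType) (n : nat) (D : design R n)
  (beta : 'cV[R]_(1 + n)) :
  ((e1 R n)^T *m MPo D beta *m e1 R n) 0 0
    = \sum_(j < dsize D) dwt D j * expR (linpred beta (dpt D j)).
Proof.
rewrite mulmx_sumr mulmx_suml summxE; apply: eq_bigr => j _.
rewrite -scalemxAr -scalemxAl mulmxA mul_e1_regf mul1mx mxE.
by rewrite -[e1 R n]trmxK -trmx_mul mul_e1_regf !mxE mulr1.
Qed.

Lemma mxtrace_mul_MPo (R : realType) (n : nat) (D : design R n)
  (beta : 'cV[R]_(1 + n)) (V : 'M[R]_(1 + n)) :
  \tr (V *m MPo D beta)
    = \sum_(j < dsize D) dwt D j * expR (linpred beta (dpt D j))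
        * ((regf (dpt D j))^T *m V *m regf (dpt D j)) 0 0.
Proof.
rewrite mulmx_sumr raddf_sum; apply: eq_bigr => j _ /=.
by rewrite -scalemxAr linearZ /= mulmxA mxtrace_mulC trace_mx11 mulmxA.
Qed.

Lemma psdmx_MPo (R : realType) (n : nat) (D : design R n)
  (beta : 'cV[R]_(1 + n)) : (forall j, 0 <= dwt D j) -> psdmx (MPo D beta).
Proof.
move=> w_ge0; rewrite /MPo; elim/big_ind: _ => [||j _].
- by split=> [|x]; rewrite ?trmx0 // mulmx0 mul0mx mxE.
- by move=> ? ?; apply: psdmxD.
apply: psdmxZ; last exact: psdmx_mul_tr.
by rewrite mulr_ge0 ?expR_ge0.
Qed.

Lemma linpredE (R : realType) (n : nat) (beta : 'cV[R]_(1 + n)) (x : 'cV[R]_n) :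
  linpred beta x = beta 0 0 + \sum_i betai beta i * x i 0.
Proof.
rewrite /linpred /regf mxE big_split_ord big_ord1 /=; congr (_ + _).
  rewrite mxE col_mxEu mxE eqxx mul1r; congr (beta _ _); exact/val_inj.
by apply: eq_bigr => i _; rewrite mxE col_mxEd mulrC.
Qed.

(* Sufficiency half of the equivalence theorem. *)
Lemma D_optimal_of_sensitivity (R : realType) (n m : nat) (a b : R)
  (u v : 'cV[R]_n) (beta : 'cV[R]_(1 + n)) (D : design R n)
  (P := MPo D beta) (c := ((e1 R n)^T *m P *m e1 R n) 0 0) :
  (0 < m)%N -> 0 < a -> 0 < b -> is_design_on u v D -> P \in unitmx ->
  (forall x, in_region u v x ->
     expR (linpred beta x) * (((regf x)^T *m invmx P *m regf x) 0 0
                              - (c + b / m%:R)^-1)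
       <= (1 + n)%:R - c / (c + b / m%:R)) ->
  D_optimal a b m u v beta D.
Proof.
move=> m_gt0 a_gt0 b_gt0 D_on unitP sens_le.
have kap_gt0 : 0 < b / m%:R :> R by rewrite divr_gt0 ?ltr0n.
have psdP : psdmx P by apply: psdmx_MPo; case: D_on.
have ck_gt0 : 0 < c + b / m%:R by rewrite ltr_wpDl //; case: psdP => _ ->.
have detP D' : is_design_on u v D' ->
    0 < \det (pg_info (b / m%:R) (e1 R n) P) /\
    \det (pg_info (b / m%:R) (e1 R n) (MPo D' beta))
      <= \det (pg_info (b / m%:R) (e1 R n) P).
  case=> w_ge0 [w_sum1 D'_on]; apply: det_pg_info_le => //.
    exact: psdmx_MPo.
  rewrite -/c MPo_intercept mxtrace_mul_MPo.
  set k := (c + _)^-1 in sens_le *.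
  (* The weights sum to 1, so the trace condition is the sensitivity bound averaged over [D']. *)
  have -> : (1 + n)%:R
      = \sum_(j < dsize D') dwt D' j * ((1 + n)%:R - c * k) + c * k.
    by rewrite -mulr_suml w_sum1 mul1r subrK.
  rewrite mulrBl [c * k - _]addrC addrA lerD2r mulr_suml -sumrB.
  apply: ler_sum => j _; rewrite -mulrBr -mulrA.
  by apply: ler_wpM2l => //; apply: sens_le.
split=> //; split=> [|D' D'_on]; rewrite !MPGE !detZ.
  by rewrite mulf_neq0 ?expf_neq0 ?gt_eqF ?divr_gt0 //; case: (detP D D_on).
by rewrite ler_pM2l ?exprn_gt0 ?divr_gt0 //; case: (detP D' D'_on).
Qed.

(** * The support of xi* and its barycentric coordinates *)

Lemma diag_mx_sum_rank1 (R : comNzRingType) (k : nat) (w : 'rV[R]_k) :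
  diag_mx w = \sum_i w 0 i *: (delta_mx i 0 *m (delta_mx i (0 : 'I_1))^T).
Proof.
rewrite diag_mx_sum_delta; apply: eq_bigr => i _.
by rewrite trmx_delta mul_delta_mx.
Qed.

(** The vector F g is the image of F^-T diag(w)^-1 g, so F cancels. With as many support points as
    parameters, this diagonalizes the variance function. *)
Lemma quad_invmx_congr_diag (R : fieldType) (k : nat) (F : 'M[R]_k)
  (w : 'rV[R]_k) (g : 'cV[R]_k) : F \in unitmx -> (forall i, w 0 i != 0) ->
  ((F *m g)^T *m invmx (F *m diag_mx w *m F^T) *m (F *m g)) 0 0
    = \sum_i g i 0 ^+ 2 / w 0 i.
Proof.
move=> unitF w_neq0.
pose W := diag_mx (\row_i (w 0 i)^-1).
have WE : diag_mx w *m W = 1%:M.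
  rewrite /W mulmx_diag -diag_const_mx; congr diag_mx.
  by apply/rowP => i; rewrite !mxE mulfV.
have unitD : diag_mx w \in unitmx by case: (mulmx1_unit WE).
have unitP : F *m diag_mx w *m F^T \in unitmx.
  by rewrite !unitmx_mul unitF unitD unitmx_tr.
have gE : F *m g = F *m diag_mx w *m F^T *m ((invmx F)^T *m W *m g).
  by rewrite trmx_inv !mulmxA mulmxK ?unitmx_tr // -(mulmxA F) WE mulmx1.
rewrite -mulmxA {2}gE mulKmx // trmx_mul -!mulmxA (mulmxA F^T) -trmx_mul.
rewrite mulVmx // trmx1 mul1mx mxE; apply: eq_bigr => i _.
by rewrite mul_diag_mx !mxE mulrC -mulrA -expr2 mulrC.
Qed.

Lemma sum_sqr_le (R : realDomainType) (I : finType) (P : pred I) (x : I -> R) :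
  (forall i, P i -> 0 <= x i) ->
  \sum_(i | P i) x i ^+ 2 <= (\sum_(i | P i) x i) ^+ 2.
Proof.
move=> x_ge0; rewrite [leRHS]expr2 mulr_suml; apply: ler_sum => i Pi.
rewrite expr2 ler_wpM2l ?x_ge0 // (bigD1 i) //= lerDl.
by apply: sumr_ge0 => j /andP[/x_ge0].
Qed.

Section Support.
Variables (R : realType) (n m : nat) (b : R) (beta : 'cV[R]_(1 + n)).
Variables (u v : 'cV[R]_n) (z : R).
Hypotheses (beta_neq0 : forall i, betai beta i != 0) (z_gt0 : 0 < z).

Local Notation d := (corner beta u v).
Local Notation xi := (xi_star b m beta u v z).
Local Notation wp := (wp_star b m beta u v z).
Local Notation w1 := (w1_star b m beta u v z).

(** The y_i of the overview; their sum is the drop of the linear predictor from its value at the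
    corner. *)
Definition slack (x : 'cV[R]_n) (i : 'I_n) : R :=
  betai beta i * (d i 0 - x i 0).

(* Its columns are the regression vectors of the support points. *)
Definition support_mx : 'M[R]_(1 + n) :=
  block_mx 1%:M 0 d 1%:M
  *m block_mx 1%:M (const_mx 1) 0 (- diag_mx (\row_i (z / betai beta i))).

(* Barycentric coordinates with respect to the support points. *)
Definition bary (x : 'cV[R]_n) : 'cV[R]_(1 + n) :=
  col_mx (1 - (\sum_i slack x i) / z)%:M (\col_i (slack x i / z)).

Lemma support_unitmx : support_mx \in unitmx.
Proof.
rewrite /support_mx unitmx_mul !unitmxE det_lblock det_ublock !det1 !mul1r.
rewrite unitr1 /= -scaleN1r detZ det_diag unitrM unitrX ?unitrN1 //= unitfE.
by apply/prodf_neq0 => i _; rewrite mxE mulf_neq0 ?invr_neq0 // lt0r_neq0.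
Qed.

Lemma regf_bary (x : 'cV[R]_n) : regf x = support_mx *m bary x.
Proof.
rewrite /support_mx /bary -mulmxA !mul_block_col !mul1mx !mul0mx addr0 add0r.
rewrite mulNmx mul_diag_mx.
have -> : (1 - (\sum_i slack x i) / z)%:M
    + const_mx 1 *m (\col_i (slack x i / z)) = 1%:M :> 'M_1.
  apply/matrixP => i j; rewrite !ord1 !mxE eqxx !mulr1n mulr_suml.
  rewrite [X in _ + X](eq_bigr (fun k => slack x k / z)) ?subrK // => k _.
  by rewrite !mxE mul1r.
rewrite mulmx1 /regf; congr col_mx; apply/colP => i; rewrite !mxE /slack !mxE.
by field; rewrite gt_eqF // beta_neq0.
Qed.

Lemma dpt_corner : dpt xi (lshift n 0 : 'I_(1 + n)) = d.
Proof. by rewrite /= (unsplitK (inl _)). Qed.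

Lemma dpt_other (i : 'I_n) :
  dpt xi (rshift 1 i : 'I_(1 + n)) = d - (z / betai beta i) *: delta_mx i 0.
Proof. by rewrite /= (unsplitK (inr _)). Qed.

Lemma dwt_corner : dwt xi (lshift n 0 : 'I_(1 + n)) = wp_star b m beta u v z.
Proof. by rewrite /= (unsplitK (inl _)). Qed.

Lemma dwt_other (i : 'I_n) :
  dwt xi (rshift 1 i : 'I_(1 + n)) = w1_star b m beta u v z.
Proof. by rewrite /= (unsplitK (inr _)). Qed.

Lemma slack_corner (i : 'I_n) : slack d i = 0.
Proof. by rewrite /slack subrr mulr0. Qed.

Lemma slack_other (i j : 'I_n) :
  slack (d - (z / betai beta i) *: delta_mx i 0) j = z * (j == i)%:R.
Proof.
rewrite /slack !mxE eqxx andbT; case: eqVneq => [->|_]; first by field.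
by rewrite !mulr0; ring.
Qed.

(** Together with [regf_bary], this diagonalizes the Poisson information of xi* by a congruence with
    [support_mx]. *)
Lemma bary_support (k : 'I_(1 + n)) : bary (dpt xi k) = delta_mx k 0.
Proof.
have z_neq0 : z != 0 by rewrite gt_eqF.
case: (split_ordP k) => i ->.
  rewrite ord1 dpt_corner /bary big1 => [|l _]; last exact: slack_corner.
  rewrite mul0r subr0; apply/colP => j.
  case: (split_ordP j) => l ->; rewrite ?(col_mxEu, col_mxEd) !mxE ?ord1 //=.
  by rewrite slack_corner mul0r.
rewrite dpt_other /bary (eq_bigr _ (fun j _ => slack_other i j)) -mulr_sumr.
rewrite (bigD1 i) //= eqxx big1 => [|j /negPf -> //].
rewrite addr0 mulr1 mulfV // subrr; apply/colP => j.
case: (split_ordP j) => l ->; rewrite ?(col_mxEu, col_mxEd) !mxE.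
  by rewrite mul0rn eq_lrshift.
by rewrite slack_other mulrAC mulfV // mul1r eq_rshift andbT.
Qed.

Lemma linpred_corner (x : 'cV[R]_n) :
  linpred beta x = linpred beta d - \sum_i slack x i.
Proof.
rewrite !linpredE -addrA -sumrB; congr (_ + _); apply: eq_bigr => i _.
by rewrite /slack; ring.
Qed.

Lemma slack_ge0 (x : 'cV[R]_n) (i : 'I_n) : in_region u v x -> 0 <= slack x i.
Proof.
move/(_ i)/andP => [ux xv]; rewrite /slack mxE; case: ifP => [b_gt0|b_le0].
  by rewrite mulr_ge0 ?subr_ge0 // ltW.
by rewrite mulr_le0 ?subr_le0 // leNgt b_le0.
Qed.

Definition omega : 'rV[R]_(1 + n) :=
  \row_k (dwt xi k * expR (linpred beta (dpt xi k))).

Lemma MPo_star : MPo xi beta = support_mx *m diag_mx omega *m support_mx^T.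
Proof.
rewrite diag_mx_sum_rank1 mulmx_sumr mulmx_suml; apply: eq_bigr => k _.
rewrite mxE -scalemxAr -scalemxAl regf_bary bary_support.
by rewrite trmx_mul !mulmxA.
Qed.

Lemma linpred_support (k : 'I_(1 + n)) :
  linpred beta (dpt xi k)
    = linpred beta d - (if split k is inl _ then 0 else z).
Proof.
rewrite linpred_corner; congr (_ - _); case: (split_ordP k) => i ->.
  by rewrite ord1 dpt_corner big1 // => l _; apply: slack_corner.
rewrite dpt_other (eq_bigr _ (fun j _ => slack_other i j)).
by rewrite -mulr_sumr (bigD1 i) //= eqxx big1 ?addr0 ?mulr1 // => j /negPf ->.
Qed.

Lemma omega_corner : omega 0 (lshift n 0) = wp * expR (linpred beta d).
Proof. by rewrite mxE dwt_corner linpred_support (unsplitK (inl _)) subr0. Qed.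

Lemma omega_other (i : 'I_n) :
  omega 0 (rshift 1 i) = w1 * expR (linpred beta d - z).
Proof. by rewrite mxE dwt_other linpred_support (unsplitK (inr _)). Qed.

Hypotheses (n_gt0 : (0 < n)%N) (m_gt0 : (0 < m)%N) (b_gt0 : 0 < b).

Lemma xi_star_design : (forall i, u i 0 < v i 0) ->
  (forall i, z <= `|betai beta i| * (v i 0 - u i 0)) -> is_design_on u v xi.
Proof.
move=> lt_uv z_le; have z_ge0 := ltW z_gt0.
have [wp_gt0 _ _] := D_weights_star beta u v n_gt0 m_gt0 b_gt0 z_ge0.
have w1_gt0 := w1_star_gt0 beta u v n_gt0 m_gt0 b_gt0 z_ge0.
split; last split.
- move=> k; case: (split_ordP k) => i ->.
    by rewrite ord1 dwt_corner ltW.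
  by rewrite dwt_other ltW.
- rewrite /= big_split_ord big_ord1 /=.
  rewrite (unsplitK (inl _)) (eq_bigr (fun=> w1)); last first.
    by move=> i _; rewrite (unsplitK (inr _)).
  rewrite sumr_const card_ord -[w1 *+ n]mulr_natl w1_starE //.
  by rewrite addrC subrK.
move=> k j; case: (split_ordP k) => i ->.
  by rewrite ord1 dpt_corner mxE; case: ifP => _; rewrite lexx ltW.
rewrite dpt_other !mxE eqxx andbT.
have := z_le i; have := lt_uv j; have := beta_neq0 i.
have [->|_] := eqVneq j i; last first.
  by rewrite mulr0 subr0 => _ lt_j _; case: ifP => _; rewrite lexx ltW.
(* The displaced coordinate starts at v_i and moves down if beta_i > 0, and starts at u_i and moves
   up if beta_i < 0; the bound on z keeps the step within the side length. *)
rewrite mulr1; case: (ltrgt0P (betai beta i)) => // [bi_gt0|bi_lt0] _ lt_i le_z.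
  have : z / betai beta i <= v i 0 - u i 0 by rewrite ler_pdivrMr // mulrC.
  have : 0 <= z / betai beta i by rewrite divr_ge0 // ltW.
  move: (z / _) => t *; lra.
have : z / - betai beta i <= v i 0 - u i 0.
  by rewrite ler_pdivrMr ?oppr_gt0 // mulrC.
have : 0 <= z / - betai beta i by rewrite divr_ge0 // oppr_ge0 ltW.
rewrite invrN mulrN; move: (z / _) => t *; lra.
Qed.

Lemma omega_gt0 (k : 'I_(1 + n)) : 0 < omega 0 k.
Proof.
have z_ge0 := ltW z_gt0.
have [wp_gt0 _ _] := D_weights_star beta u v n_gt0 m_gt0 b_gt0 z_ge0.
have w1_gt0 := w1_star_gt0 beta u v n_gt0 m_gt0 b_gt0 z_ge0.
case: (split_ordP k) => i ->.
  by rewrite ord1 omega_corner mulr_gt0 ?expR_gt0.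
by rewrite omega_other mulr_gt0 ?expR_gt0.
Qed.

Lemma MPo_star_intercept :
  ((e1 R n)^T *m MPo xi beta *m e1 R n) 0 0
    = n%:R * (w1 * expR (linpred beta d - z)) + wp * expR (linpred beta d).
Proof.
rewrite MPo_intercept (eq_bigr (omega 0)) => [|k _]; last by rewrite mxE.
rewrite big_split_ord big_ord1 /= omega_corner.
rewrite (eq_bigr _ (fun i _ => omega_other i)).
by rewrite sumr_const card_ord -[_ *+ n]mulr_natl addrC.
Qed.

Lemma MPo_star_unitmx : MPo xi beta \in unitmx.
Proof.
rewrite MPo_star 2!unitmx_mul unitmx_tr support_unitmx andbT /=.
rewrite unitmxE det_diag unitfE.
by apply/prodf_neq0 => k _; rewrite gt_eqF ?omega_gt0.
Qed.

(** The variance is a weighted sum of squared barycentric coordinates. The corner term is kept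
    exactly; in the others the sum of squares of nonnegative numbers is at most the square of their
    sum. *)
Lemma variance_le (x : 'cV[R]_n) (s := \sum_i slack x i) : in_region u v x ->
  ((regf x)^T *m invmx (MPo xi beta) *m regf x) 0 0
    <= (s / z) ^+ 2 / (w1 * expR (linpred beta d - z))
       + (1 - s / z) ^+ 2 / (wp * expR (linpred beta d)).
Proof.
move=> x_in; have z_ge0 := ltW z_gt0.
rewrite MPo_star regf_bary quad_invmx_congr_diag ?support_unitmx //; last first.
  by move=> k; rewrite gt_eqF ?omega_gt0.
rewrite big_split_ord big_ord1 /= omega_corner addrC /bary col_mxEu mxE eqxx.
rewrite mulr1n lerD2r.
rewrite (eq_bigr (fun i =>
  (slack x i / z) ^+ 2 / (w1 * expR (linpred beta d - z)))).
  have w1_gt0 := w1_star_gt0 beta u v n_gt0 m_gt0 b_gt0 z_ge0.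
  rewrite -mulr_suml ler_pM2r; last by rewrite invr_gt0 mulr_gt0 ?expR_gt0.
  rewrite /s mulr_suml; apply: sum_sqr_le => i _.
  by rewrite divr_ge0 // slack_ge0.
by move=> i _; rewrite col_mxEd mxE omega_other.
Qed.
End Support.

Theorem theorem8 (R : realType) (n : nat) (m : nat) (a b : R)
  (u v : 'cV[R]_n) (beta : 'cV[R]_(1 + n)) :
  (1 <= n)%N -> (0 < m)%N -> 0 < a -> 0 < b ->
  (forall i, u i 0 < v i 0) ->
  (forall i, betai beta i != 0) ->
  (exists! z : R, 0 < z /\ zeq b m beta u v z = 0) /\
  (forall z : R, 0 < z -> zeq b m beta u v z = 0 ->
     (forall i, z <= `|betai beta i| * (v i 0 - u i 0)) ->
     D_optimal a b m u v beta (xi_star b m beta u v z)).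
Proof.
move=> n_gt0 m_gt0 a_gt0 b_gt0 lt_uv beta_neq0.
split=> [|z z_gt0 z_root z_le]; first exact: zeq_unique_root.
apply: D_optimal_of_sensitivity => // [||x x_in].
- exact: xi_star_design.
- exact: MPo_star_unitmx.
rewrite MPo_star_intercept // (linpred_corner beta u v).
have s_ge0 : 0 <= \sum_i slack beta u v x i.
  by apply: sumr_ge0 => i _; apply: slack_ge0.
(* This bound involves x only through its total slack; [variance_le] reduces the sensitivity at x to
   it. *)
have := sensitivity_star_le n_gt0 m_gt0 b_gt0 z_gt0 z_root s_ge0.
apply: le_trans; rewrite ler_pM2l ?expR_gt0 // lerD2r.
exact: variance_le.
Qed.
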